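(* Let $B$ be a complete Boolean algebra. If $(B,\tau_s)$ is a Hausdorff space then $B$ is $(\omega,\omega_1)$-weakly distributive.
   Context: For a sequence $\langle b_n\rangle$ in $B$, let $\overline{\lim}\, b_n=\bigwedge_k\bigvee_{n\ge k}b_n$ and $\underline{\lim}\, b_n=\bigvee_k\bigwedge_{n\ge k}b_n$; the sequence algebraically converges to $b$ if both equal $b$. The sequential topology $\tau_s$ on $B$ is the largest topology on $B$ in which every algebraically convergent sequence converges to its algebraic limit. For an infinite cardinal $\kappa$, $B$ is $(\omega,\kappa)$-weakly distributive if for every sequence $\{P_n\}_{n\in\omega}$ of maximal antichains, each of size at most $\kappa$, there exists a dense set $Q$ (every nonzero $b$ has a nonzero $q\in Q$ with $q\le b$) such that each $q\in Q$ has nonzero meet with only finitely many elements of each $P_n$. *)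

(* Defs.v *)
From HB Require Import structures.
From mathcomp Require Import all_boot all_order.
From mathcomp Require Import all_classical wochoice topology.

Set Implicit Arguments.
Unset Strict Implicit.
Unset Printing Implicit Defensive.

Local Open Scope classical_set_scope.
Local Open Scope card_scope.

(** Boolean algebras are [ctbDistrLatticeType]s (complemented distributive
    lattices with bottom and top). *)

Section BooleanAlgebra.
Context {d : Order.disp_t} (B : ctbDistrLatticeType d).
Implicit Types (u : nat -> B) (b : B) (A Q : set B).

Definition complete_algebra : Prop := forall A : set B, exists s : B, supremums A s.

(* The first argument of [supremum] and [infimum] is only a default value,
   never used when B is complete since the sets below are non-empty. *)
Definition alg_limsup u : B :=
  infimum \top%O
    (range (fun k => supremum \bot%O [set u n | n in [set n | (k <= n)%N]])).

Definition alg_liminf u : B :=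
  supremum \bot%O
    (range (fun k => infimum \top%O [set u n | n in [set n | (k <= n)%N]])).

Definition alg_cvg u b : Prop := alg_limsup u = b /\ alg_liminf u = b.

Definition antichain A : Prop :=
  (forall a, A a -> a <> \bot%O) /\
  (forall a a', A a -> A a' -> a <> a' -> Order.meet a a' = \bot%O).

Definition maximal_antichain A : Prop :=
  antichain A /\ (forall A', antichain A' -> A `<=` A' -> A' = A).

Definition dense_subset Q : Prop :=
  forall b, b <> \bot%O -> exists q, [/\ Q q, q <> \bot%O & (q <= b)%O].

(* The cardinal kappa is represented by an arbitrary set K of that
   cardinality. *)
Definition weakly_distributive {T : Type} (K : set T) : Prop :=
  forall P : nat -> set B,
    (forall n, maximal_antichain (P n)) ->
    (forall n, P n #<= K) ->
  exists Q : set B, dense_subset Q /\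
    forall q, Q q -> forall n,
      finite_set [set p | P n p /\ Order.meet q p <> \bot%O].

End BooleanAlgebra.

Definition is_topology {T : Type} (tau : set (set T)) : Prop :=
  [/\ tau setT,
      forall U V, tau U -> tau V -> tau (U `&` V) &
      forall F : set (set T), F `<=` tau -> tau (\bigcup_(U in F) U)].

Definition topology_cvg {T : Type} (tau : set (set T)) (u : nat -> T) (b : T) :
  Prop := forall U, tau U -> U b -> \forall n \near \oo, U (u n).

Definition alg_compatible {d} {B : ctbDistrLatticeType d} (tau : set (set B)) :
  Prop := forall u b, alg_cvg u b -> topology_cvg tau u b.

(* The union of all topologies in which algebraic convergence implies
   convergence. It is itself such a topology (cf. the topologicalType instance
   below and [seq_space_cvg]), hence the largest one ([seq_space_max]). *)
Definition seq_open {d} {B : ctbDistrLatticeType d} : set (set B) :=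
  [set U | exists tau, [/\ is_topology tau, alg_compatible tau & tau U]].

Lemma seq_openP {d} {B : ctbDistrLatticeType d} (U : set B) :
  seq_open U <->
  (forall u b, alg_cvg u b -> U b -> \forall n \near \oo, U (u n)).
Proof.
split=> [[tau [_ ctau tauU]] u b ub Ub|sU]; first exact: (ctau _ _ ub).
exists [set V : set B |
  forall u b, alg_cvg u b -> V b -> \forall n \near \oo, V (u n)].
split=> //; last by move=> u b ub V sV; apply: sV.
split=> [u b _ _|V W sV sW u b ub [Vb Wb]|F sF u b ub [V FV Vb]].
- exact: nearW.
- by apply: filterI; [exact: sV ub Vb|exact: sW ub Wb].
- by apply: filterS (sF _ FV u b ub Vb) => n Vn; exists V.
Qed.

Definition seq_space {d} (B : ctbDistrLatticeType d) : Type := B.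

Section SeqSpace.
Context {d : Order.disp_t} (B : ctbDistrLatticeType d).

HB.instance Definition _ := Choice.copy (seq_space B) B.

Let opT : @seq_open d B setT.
Proof. by apply/seq_openP => *; exact: nearW. Qed.

Let opI : setI_closed (@seq_open d B).
Proof.
move=> V W /seq_openP sV /seq_openP sW; apply/seq_openP => u b ub [Vb Wb].
by apply: filterI; [exact: sV ub Vb|exact: sW ub Wb].
Qed.

Let opU (I : Type) (f : I -> set B) :
  (forall i, seq_open (f i)) -> seq_open (\bigcup_i f i).
Proof.
move=> sf; apply/seq_openP => u b ub [i _ fib].
have /seq_openP/(_ u b ub fib) := sf i.
by apply: filterS => n fin; exists i.
Qed.

HB.instance Definition _ :=
  @isOpenTopological.Build (seq_space B) (@seq_open d B) opT opI opU.

Lemma seq_space_cvg (u : nat -> B) (b : B) : alg_cvg u b ->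
  (u : nat -> seq_space B) @ \oo --> (b : seq_space B).
Proof.
move=> ub V [W [oW Wb sWV]]; move/seq_openP: oW => /(_ u b ub Wb).
by apply: filterS => n /sWV.
Qed.

Lemma seq_space_max (tau : set (set B)) :
  is_topology tau -> alg_compatible tau -> tau `<=` @open (seq_space B).
Proof. by move=> ttau ctau U tU; exists tau. Qed.

End SeqSpace.

(** The first uncountable ordinal, realised as the initial segment of a
    well-ordered copy of the continuum formed by the points with countably many
    predecessors; [omega1_uncountable] and [omega1_least] show that it
    represents the least uncountable cardinal. *)

Definition continuum_order : rel (set nat) :=
  sval (well_ordering_principle (set nat)).

Definition omega1 : set (set nat) :=
  [set x | countable [set y | continuum_order y x]].

Section Omega1.
Local Notation R := continuum_order.

Lemma continuum_order_min (A : set (set nat)) : A !=set0 ->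
  exists2 z, A z & forall y, A y -> R z y.
Proof.
move=> [x Ax].
have [|z [[/asboolP Az lz] _]] :=
  svalP (well_ordering_principle (set nat)) [pred x | `[< A x >]].
  by exists x; apply/asboolP.
by exists z => // y Ay; apply: lz; apply/asboolP.
Qed.

Lemma continuum_order_total x y : R x y \/ R y x.
Proof.
have [|z] := @continuum_order_min [set x; y]; first by exists x; left.
by move=> [->|->] zR; [left; apply: zR; right|right; apply: zR; left].
Qed.

Lemma continuum_order_anti x y : R x y -> R y x -> x = y.
Proof.
move=> xy yx; pose A := [pred z : set nat | `[< z = x \/ z = y >]].
have [|z [_ zU]] := svalP (well_ordering_principle (set nat)) A.
  by exists x; apply/asboolP; left.
have xx : R x x by case: (continuum_order_total x x).
have yy : R y y by case: (continuum_order_total y y).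
have zx : z = x.
  by apply: zU; split; [apply/asboolP; left|move=> t /asboolP[]->].
have zy : z = y.
  by apply: zU; split; [apply/asboolP; right|move=> t /asboolP[]->].
by rewrite -zx.
Qed.

Lemma omega1_uncountable : ~ countable omega1.
Proof.
move=> comega1.
have omega1T x : omega1 x.
  apply: contrapT => /(ex_intro (~` omega1)).
  move=> /continuum_order_min[z nz zmin]; apply: nz.
  have cz : countable (\bigcup_(b in [set: bool])
      (if b then omega1 else [set z])).
    by apply: bigcup_countable => // -[].
  apply: sub_countable cz; apply: subset_card_le => y /= yz.
  have [oy|noy] := pselect (omega1 y); first by exists true.
  by exists false => //=; exact: continuum_order_anti yz (zmin _ noy).
move: comega1 => /countable_injP[g ginj].
have {}ginj x y : g x = g y -> x = y by apply: ginj; apply/mem_set.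
pose D := [set n | exists2 x, g x = n & ~ x n].
have nD : ~ D (g D) by move=> Dg; case: (Dg) => x /ginj ->; exact.
by apply: (nD); exists D.
Qed.

Lemma omega1_least (T : Type) (X : set T) : ~ countable X -> omega1 #<= X.
Proof.
move=> ncX.
pose lt x y := R x y /\ x <> y.
have lt_wf : well_founded lt.
  move=> x; apply: contrapT => /(ex_intro (fun x => ~ Acc lt x)).
  move=> /continuum_order_min[z nz zmin]; apply: nz; constructor=> y [yz].
  by move=> neq; apply: contrapT => /zmin/(continuum_order_anti yz).
have [t0 _] : X !=set0.
  by apply/set0P/eqP => X0; apply: ncX; rewrite X0; exact: countable0.
pose step x (rec : forall y, lt y x -> T) : T :=
  if pselect (exists t, X t /\ ~ exists y (yx : lt y x), rec y yx = t) is left h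
  then sval (cid h) else t0.
pose f := Fix lt_wf (fun=> T) step.
have fE x : f x = step x (fun y _ => f y).
  rewrite /f Fix_eq// => {}x g h gh; congr (step x _).
  by apply: functional_extensionality_dep => y; apply: funext.
have fP x : omega1 x -> X (f x) /\ forall y, lt y x -> f y <> f x.
  move=> ox; rewrite (fE x) /step; case: pselect => [h|].
    case: cid => t [Xt nt] /=; split=> // y yx fyt.
    by apply: nt; exists y, yx.
  move=> /forallNP H; exfalso; apply: ncX.
  have cfx : countable (f @` [set y | R y x]).
    exact: sub_countable (card_image_le _ _) ox.
  apply: sub_countable cfx; apply: subset_card_le => t Xt.
  have := H t; move=> /not_andP[//|/contrapT[y [[yx _] <-]]].
  by exists y.
have finj : {in omega1 &, injective f}.
  move=> x y /set_mem ox /set_mem oy fxy; apply: contrapT => xy.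
  case: (continuum_order_total x y) => le.
    by have [_ /(_ x)] := fP _ oy; apply.
  have [_ /(_ y)] := fP _ ox; apply=> //.
  by split=> // yx; exact: xy.
rewrite -(card_le_eql (inj_card_eq finj)); apply: subset_card_le.
by move=> _ [x /fP[Xx _] <-].
Qed.

End Omega1.

(* Main.v *)
Require Import Defs.
From HB Require Import structures.
From mathcomp Require Import all_boot all_order.
From mathcomp Require Import all_classical wochoice topology.

(** Suppose weak distributivity fails below [a <> \bot], i.e. no nonzero [r <= a]
    meets only finitely many elements of each [P n].

    If the antichains become countable below some nonzero [q <= a], let [b n k]
    be the join of all but the first [k] elements of [P n] below [q]. As
    [x `|` b n k] converges to [x] in [k], every open [U] containing [\bot]
    contains the finite joins [b 0 (h 0) `|` ... `|` b n (h n)] for a suitable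
    [h]. By failure of weak distributivity they increase to [q], so [\bot] and
    [q] cannot be separated.

    Otherwise [a] forces the [P n] to define a map from [nat] cofinal in
    [omega1], hence also one [g] onto [omega1]. Put
    [y t k := a `&` [[t is not in g(0..k-1)]]]. For fixed [t], [y t k] converges to
    [\bot], so a given open [U] containing [\bot] contains [y t (k t)] for some
    [k t]. Some [k] serves infinitely many [t]; along distinct such [t], [y t k]
    converges to [a] because only [k] values of [t] can occur in [g(0..k-1)].
    So [\bot] and [a] cannot be separated. *)

Import Order.Theory.
Local Open Scope classical_set_scope.
Local Open Scope order_scope.

(** * Suprema, antichains and algebraic convergence *)

Section CompleteAlgebra.
Context {d : Order.disp_t} {B : ctbDistrLatticeType d}.
Hypothesis B_complete : complete_algebra B.
Implicit Types (A : set B) (u : nat -> B) (b q r w x y : B).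

Lemma complete_infimums A : exists s, infimums A s.
Proof.
have [s [us ls]] := B_complete (lbound A); exists s; split=> [x Ax|x].
  by apply: ls => y; exact.
exact: us.
Qed.

Lemma supremum_ge x0 A x : A x -> x <= supremum x0 A.
Proof.
move=> Ax; rewrite /supremum; case: ifPn => [/eqP A0|_]; first by rewrite A0 in Ax.
case: xgetP => [_ -> [ub _]|H]; first exact: ub.
by have [s /H] := B_complete A.
Qed.

Lemma supremum_le A y : (forall x, A x -> x <= y) -> supremum \bot A <= y.
Proof.
move=> Ay; rewrite /supremum; case: ifPn => _; first exact: le0x.
case: xgetP => [_ -> [_ lb]|H]; first exact: lb.
by have [s /H] := B_complete A.
Qed.

Lemma infimum_le x0 A x : A x -> infimum x0 A <= x.
Proof.
move=> Ax; rewrite /infimum; case: ifPn => [/eqP A0|_]; first by rewrite A0 in Ax.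
case: xgetP => [_ -> [lb _]|H]; first exact: lb.
by have [s /H] := complete_infimums A.
Qed.

Lemma infimum_ge A y : (forall x, A x -> y <= x) -> y <= infimum \top A.
Proof.
move=> Ay; rewrite /infimum; case: ifPn => _; first exact: lex1.
case: xgetP => [_ -> [_ ub]|H]; first exact: ub.
by have [s /H] := complete_infimums A.
Qed.

Lemma meet_supremum_eq0 A w : (forall x, A x -> w `&` x = \bot) ->
  w `&` supremum \bot A = \bot.
Proof.
move=> Aw; apply/eqP; rewrite meetC disj_leC; apply: supremum_le => x Ax.
by rewrite -disj_leC meetC Aw.
Qed.

Lemma meet_neq0_le w w' x : w' <= w -> w' `&` x <> \bot -> w `&` x <> \bot.
Proof.
move=> ww' H wx; apply: H; apply/eqP; rewrite -lex0 -wx.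
exact: leI2.
Qed.

(** Otherwise [w] could be adjoined to [A]. *)
Lemma maximal_antichain_meet A w : maximal_antichain A -> w <> \bot ->
  exists2 p, A p & w `&` p <> \bot.
Proof.
move=> [[An0 Adisj] Amax] w0; apply: contrapT => H.
have {}H p : A p -> w `&` p = \bot.
  by move=> Ap; apply: contrapT => wp; apply: H; exists p.
have E : A `|` [set w] = A.
  apply: Amax => [|x Ax]; last by left.
  split=> [x [/An0//|->//]|x y [Ax|->] [Ay|->] //].
  - exact: Adisj.
  - by rewrite meetC H.
  - by rewrite H.
have Aw : A w by rewrite -E; right.
by have := H _ Aw; rewrite meetxx.
Qed.

(* In forcing terms: [b] is the eventual value of [u] in every extension. *)
Lemma alg_cvg_dense u b :
  (forall w, w <> \bot -> exists w' N, [/\ w' <> \bot, w' <= w &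
     forall n, (N <= n)%N -> w' `&` u n = w' `&` b]) ->
  alg_cvg u b.
Proof.
move=> H.
have lL : alg_liminf u <= alg_limsup u.
  apply: supremum_le => _ [k _ <-]; apply: infimum_ge => _ [m _ <-].
  apply: (@le_trans _ _ (u (maxn k m))).
    by apply: infimum_le; exists (maxn k m) => //=; rewrite leq_maxl.
  by apply: supremum_ge; exists (maxn k m) => //=; rewrite leq_maxr.
(* A nonzero [w'] below both the limsup and the complement of [b] would be eventually disjoint from
   [u n], hence from the limsup. *)
have Lb : alg_limsup u <= b.
  rewrite -[b]complK -disj_leC; apply/eqP; apply: contrapT => nz.
  have [w' [N [w'0 w'le w'E]]] := H _ nz.
  apply: w'0; move: w'le; rewrite lexI => /andP[w'L w'b].
  have Lle : alg_limsup u <= ~` w'.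
    apply: (@le_trans _ _ (supremum \bot [set u n | n in [set n | (N <= n)%N]])).
      by apply: infimum_le; exists N.
    apply: supremum_le => _ [n Nn <-]; rewrite -disj_leC meetC w'E//.
    by rewrite -[b]complK disj_leC complK.
  by apply/eqP; rewrite -(meetxx w') disj_leC (le_trans w'L).
have bl : b <= alg_liminf u.
  rewrite -[alg_liminf u]complK -disj_leC.
  apply/eqP; apply: contrapT => nz.
  have [w' [N [w'0 w'le w'E]]] := H _ nz.
  apply: w'0; move: w'le; rewrite lexI => /andP[w'b w'l].
  apply/eqP; rewrite -(meetxx w') disj_leC (le_trans w'l)// leC.
  apply: (@le_trans _ _ (infimum \top [set u n | n in [set n | (N <= n)%N]])).
    apply: infimum_ge => _ [n Nn <-]; rewrite -(meet_l w'b) -(w'E _ Nn).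
    exact: leIr.
  by apply: supremum_ge; exists N.
split; apply/le_anti/andP; split => //.
- exact: le_trans lL.
- exact: le_trans Lb.
Qed.

(** * Two consequences of the Hausdorff property *)

Hypothesis B_hausdorff : hausdorff_space (seq_space B).

Lemma hausdorff_separation x y : x <> y -> exists U V : set B,
  [/\ forall u b, alg_cvg u b -> U b -> \forall n \near \oo, U (u n),
      forall u b, alg_cvg u b -> V b -> \forall n \near \oo, V (u n),
      U x, V y & forall z, U z -> V z -> False].
Proof.
move=> xy; apply: contrapT => H; apply: xy.
apply: (B_hausdorff (x : seq_space B) y) => U' V'.
move=> [U [/seq_openP oU Ux UU']] [V [/seq_openP oV Vy VV']].
apply: contrapT => UV; apply: H; exists U, V; split=> // z Uz Vz; apply: UV.
by exists z; split; [exact: UU'|exact: VV'].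
Qed.

Lemma countable_weakly_distributive q (P : nat -> set B) :
  q <> \bot -> (forall n, maximal_antichain (P n)) ->
  (forall n, countable [set p | P n p /\ q `&` p <> \bot]) ->
  exists r, [/\ r <> \bot, r <= q &
    forall n, finite_set [set p | P n p /\ r `&` p <> \bot]].
Proof.
move=> q0 Pmax Pc; apply: contrapT => noR.
have [i iinj] : exists i : nat -> B -> nat, forall n p p', P n p -> P n p' ->
    q `&` p <> \bot -> q `&` p' <> \bot -> i n p = i n p' -> p = p'.
  have /choice[i ii] n := countable_injP _ (Pc n).
  by exists i => n p p' Pp Pp' qp qp'; apply: ii; apply/mem_set.
pose b n k := supremum \bot
  [set q `&` p | p in [set p | [/\ P n p, q `&` p <> \bot & (k <= i n p)%N]]].
have bq n k : b n k <= q by apply: supremum_le => _ [p _ <-]; exact: leIl.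
have b_cvg x n : alg_cvg (fun k => x `|` b n k) x.
  apply: alg_cvg_dense => w w0.
  have [wq|/(maximal_antichain_meet _ _ (Pmax n))[p Pp wp]] :=
    pselect (w `&` q = \bot).
    exists w, 0; split=> // k _; rewrite meetUr.
    suff -> : w `&` b n k = \bot by rewrite joinx0.
    by apply/eqP; rewrite -lex0 -wq leI2.
  (* Elements of index above [i n p] differ from [p], hence are disjoint from it. *)
  exists (w `&` q `&` p), (i n p).+1; split=> //; first by rewrite -meetA leIl.
  move=> k ik; rewrite meetUr.
  suff -> : w `&` q `&` p `&` b n k = \bot by rewrite joinx0.
  apply: meet_supremum_eq0 => _ [p' [Pp' qp' kp'] <-].
  have pp' : p <> p' by move=> pp'; move: kp'; rewrite -pp' leqNgt ik.
  have [[_ /(_ _ _ Pp Pp' pp') pp'0] _] := Pmax n.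
  apply/eqP; rewrite -lex0 -pp'0 leI2//.
    exact: leIr.
  exact: leIr.
have [U [V [oU oV U0 Vq UV]]] := hausdorff_separation _ _ (nesym q0).
(* [K] takes the current join as an argument, so that [x] can be built by recursion inside [U]. *)
have /choice[K UK] (xn : B * nat) :
    exists k, U xn.1 -> U (xn.1 `|` b xn.2 k).
  have [Ux|nUx] := pselect (U xn.1); last by exists 0.
  by have [N _ /(_ N (leqnn N)) UN] := oU _ _ (b_cvg xn.1 xn.2) Ux; exists N.
pose x := fix x n := if n is m.+1 then x m `|` b m (K (x m, m)) else \bot.
have Ux n : U (x n) by elim: n => //= n /(UK (x n, n)).
have xq n : x n <= q by elim: n => [|n IH] /=; rewrite ?le0x// leUx IH bq.
have xb m n : (m < n)%N -> b m (K (x m, m)) <= x n.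
  elim: n => // n IH; rewrite ltnS leq_eqVlt => /orP[/eqP ->|/IH mn] /=.
    exact: leUr.
  by apply: (le_trans mn); exact: leUl.
suff /oV/(_ Vq)[N _ /(_ N (leqnn N))] : alg_cvg x q by apply: UV.
apply: alg_cvg_dense => w w0.
have [wq|wq] := pselect (w `&` q = \bot).
  exists w, 0; split=> // n _; rewrite wq.
  by apply/eqP; rewrite -lex0 -wq leI2.
(* If the meet of [w] and [q] missed all these tails, it could meet only elements of [P n] of index
   below [K (x n, n)], contradicting [noR]. *)
have [n wb] : exists n, w `&` q `&` b n (K (x n, n)) <> \bot.
  apply: contrapT => /forallNP H; apply: noR; exists (w `&` q).
  have {}H n := contrapT (H n).
  split=> // [|n]; first exact: leIr.
  pose D := [set p | P n p /\ w `&` q `&` p <> \bot].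
  have qD p : D p -> q `&` p <> \bot.
    by move=> [_]; apply: meet_neq0_le; exact: leIr.
  have iinjD : {in D &, injective (i n)}.
    move=> p p' /set_mem Dp /set_mem Dp' E.
    by apply: (iinj n) E; [case: Dp|case: Dp'|exact: qD|exact: qD].
  rewrite -/D -(eq_finite_set (inj_card_eq iinjD)).
  apply: (@sub_finite_set _ _ `I_(K (x n, n))) => // _ [p Dp <-] /=.
  rewrite ltnNge; apply/negP => Kp; case: (Dp) => Pp; apply.
  apply/eqP; rewrite -lex0 -(H n) lexI leIl/=.
  apply: (@le_trans _ _ (q `&` p)); first by rewrite leI2// leIr.
  by apply: supremum_ge; exists p => //; split=> //; exact: qD.
exists (w `&` q `&` b n (K (x n, n))), n.+1; split=> // [|m nm].
  by rewrite -meetA leIl.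
have bx := le_trans (leIr (b n (K (x n, n))) (w `&` q)) (xb _ _ nm).
by rewrite (meet_l bx) (meet_l (le_trans bx (xq m))).
Qed.

(* The hypotheses say that [n |-> the x such that c n x] is forced by [q] to map
   onto [I]: below [q], the uncountable set [I] is collapsed to a countable
   one. *)
Lemma hausdorff_no_collapse (T : pointedType) (I : set T) q (c : nat -> T -> B) :
  ~ countable I -> q <> \bot ->
  (forall n s t, I s -> I t -> s <> t -> c n s `&` c n t = \bot) ->
  (forall t w, I t -> w <> \bot -> w <= q -> exists n, w `&` c n t <> \bot) ->
  False.
Proof.
move=> Inc q0 cdisj conto.
have [U [V [oU oV U0 Vq UV]]] := hausdorff_separation _ _ (nesym q0).
pose y t k := q `&` ~` (\join_(n < k) c n t).
have y_cvg0 t : I t -> alg_cvg (y t) \bot.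
  move=> It; apply: alg_cvg_dense => w w0; rewrite /y.
  have [wq|wq] := pselect (w `&` q = \bot).
    by exists w, 0; split=> // k _; rewrite meetA wq meet0x meetx0.
  have [n wc] := conto _ _ It wq (leIr _ _).
  (* From [n.+1] on, [y t k] excludes [c n t]. *)
  exists (w `&` q `&` c n t), n.+1; split=> //; first by rewrite -meetA leIl.
  move=> k nk; rewrite meetx0; apply/eqP.
  rewrite disj_leC lexC; apply: (le_trans (leIr _ _)).
  rewrite leC; apply: le_trans (leIr _ _) _.
  exact: (@joins_sup _ _ _ (Ordinal nk) predT (fun i : 'I_k => c i t)).
have [k Ik] : exists k, infinite_set [set t | I t /\ U (y t k)].
  apply: contrapT => /forallNP H; apply: Inc.
  apply: (@sub_countable _ _ _
    (\bigcup_(k in [set: nat]) [set t | I t /\ U (y t k)])); last first.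
    by apply: bigcup_countable => // k _; exact: finite_set_countable (contrapT (H k)).
  apply: subset_card_le => t It.
  by have [N _ /(_ N (leqnn N)) UN] := oU _ _ (y_cvg0 t It) U0; exists N.
have [t tI tinj] : exists2 t : nat -> T,
    forall j, I (t j) /\ U (y (t j) k) & injective t.
  move/infiniteP/pcard_leP/injfunPex: Ik => [t tI tinj]; exists t => [j|i j tij].
    exact: tI.
  by apply: tinj tij; rewrite inE.
suff /oV/(_ Vq)[N _ /(_ N (leqnn N))] : alg_cvg (fun j => y (t j) k) q.
  by apply: UV; case: (tI N).
apply: alg_cvg_dense => w w0.
(* It is enough to shrink [w] until the first [k] values of the collapsing map avoid a tail of
   [t]. *)
suff [w' [N [w'0 w'w w'N]]] : exists w' N, [/\ w' <> \bot, w' <= w &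
    forall n j, (n < k)%N -> (N <= j)%N -> w' `&` c n (t j) = \bot].
  exists w', N; split=> // j Nj; rewrite /y meetCA [RHS]meetC; congr (_ `&` _).
  apply/meet_idPl; rewrite lexC; apply/joinsP => n _.
  by rewrite lexC -disj_leC w'N.
(* Only [I (t j)] is kept from [tI], since its other half depends on [k]. *)
elim: {y y_cvg0 Ik tI} k (fun j => (tI j).1) => [|k IH] It.
  by exists w, 0; split.
have [w' [N [w'0 w'w w'N]]] := IH It.
have [H|/existsNP[j wj]] := pselect (forall j, w' `&` c k (t j) = \bot).
  exists w', N; split=> // n j; rewrite ltnS leq_eqVlt => /orP[/eqP -> //|].
  exact: w'N.
(* This decides the value at [k] to be [t j], which excludes every later [t i]. *)
exists (w' `&` c k (t j)), (maxn N j.+1); split=> //.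
  exact: le_trans (leIl _ _) w'w.
move=> n i; rewrite ltnS geq_max => nk /andP[Ni ji].
move: nk; rewrite leq_eqVlt => /orP[/eqP ->|nk].
  rewrite -meetA cdisj ?meetx0// => /tinj ij.
  by move: ji; rewrite ij ltnn.
by rewrite meetAC w'N// meet0x.
Qed.

End CompleteAlgebra.

(** * Collapse of [omega1] from a failure of weak distributivity *)

Theorem theorem4p1 (d : Order.disp_t) (B : ctbDistrLatticeType d)
    (B_complete : complete_algebra B)
    (B_hausdorff : hausdorff_space (seq_space B)) :
  weakly_distributive B omega1.
Proof.
move=> P Pmax Pc.
(* The largest candidate for [Q]; only its density is at stake. *)
exists [set q | forall n, finite_set [set p | P n p /\ q `&` p <> \bot]].
split=> // a a0; apply: contrapT => noR.
have {}noR r : r <> \bot -> r <= a ->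
    ~ forall n, finite_set [set p | P n p /\ r `&` p <> \bot].
  by move=> r0 ra rP; apply: noR; exists r.
have /choice[j jP] n : exists j : B -> set nat,
    (forall p, P n p -> omega1 (j p)) /\
    (forall p p', P n p -> P n p' -> j p = j p' -> p = p').
  have /pcard_leP/injfunPex[j jo ji] := Pc n; exists j; split=> // p p' Pp Pp'.
  by apply: ji; apply/mem_set.
have /choice[e eP] x : exists e : set nat -> nat, omega1 x ->
    forall y y', continuum_order y x -> continuum_order y' x -> e y = e y' -> y = y'.
  have [/countable_injP[e ei]|] := pselect (omega1 x); last by exists (fun=> 0).
  by exists e => _ y y' yx y'x; apply: ei; apply/mem_set.
(* Truth value of "[t] is the [m]-th predecessor of the [n]-th ordinal", with
   [N] coding [(n, m)]. *)
pose c N t := supremum \bot [set p | exists n,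
  [/\ P n p, continuum_order t (j n p) & N = pickle (n, e (j n p) t)]].
apply: (@hausdorff_no_collapse _ _ B_complete B_hausdorff _ omega1 a c) => //.
- exact: omega1_uncountable.
(* Equal codes force the same [n]; then [p = p'] would give [s = t] by injectivity of [e (j n p)],
   and otherwise [p] and [p'] are disjoint. *)
- move=> N s t _ _ st; apply: meet_supremum_eq0 => // p' [n' [Pp' tp' N']].
  rewrite meetC; apply: meet_supremum_eq0 => // p [n [Pp sp NE]].
  move: N'; rewrite NE => /(pcan_inj pickleK)[nn'].
  subst n' => E; have [[_ Pdisj] _] := Pmax n.
  apply: Pdisj => // pp'; subst p'; apply: st.
  by apply: eP sp tp' E; exact: (jP n).1.
- move=> t w ot w0 wa; apply: contrapT => /forallNP H.
  (* If [w] misses every [c N t], each [p] in [P n] meeting [w] has [j n p] at most [t]. These are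
     countably many, so the countable case contradicts [noR]. *)
  have [|r [r0 rw]] :=
    @countable_weakly_distributive _ _ B_complete B_hausdorff w P w0 Pmax.
    move=> n; have jinj : {in [set p | P n p /\ w `&` p <> \bot] &, injective (j n)}.
      by move=> p p' /set_mem[Pp _] /set_mem[Pp' _]; exact: (jP n).2.
    rewrite -(eq_countable (inj_card_eq jinj)).
    apply: sub_countable ot; apply: subset_card_le => _ [p [Pp wp] <-] /=.
    have [//|tp] := continuum_order_total (j n p) t.
    have /contrapT wc := H (pickle (n, e (j n p) t)).
    exfalso; apply: wp; apply/eqP; rewrite -lex0 -wc leI2//.
    by apply: supremum_ge => //; exists n.
  by apply: noR => //; exact: le_trans rw wa.
Qed.
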